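(* If a metric family $\mathcal{X}$ has regular finite decomposition complexity, then $\mathcal{X}$ has finite decomposition complexity (FDC).
   Context: A metric family is a set of metric spaces. A map of metric families $F\colon\mathcal{X}\to\mathcal{Y}$ is a collection of functions $f\colon X\to Y$ with $X\in\mathcal{X}$, $Y\in\mathcal{Y}$, such that each element of $\mathcal{X}$ is the domain of at least one function in $F$. $F$ is coarse if there is a non-decreasing function $\rho\colon[0,\infty)\to[0,\infty)$ with $d_Y(f(x),f(y))\le\rho(d_X(x,y))$ for all $f\colon X\to Y$ in $F$ and $x,y\in X$. A subfamily of $\mathcal{Y}$ is a metric family each of whose members is a subspace of some $Y\in\mathcal{Y}$; the inverse image of a subfamily $\mathcal{B}$ is $F^{-1}(\mathcal{B})=\{f^{-1}(B)\mid B\in\mathcal{B},\ f\in F\}$ (where $B$ is a subspace of the codomain of $f$). $\mathcal{X}$ is bounded if $\sup_{X\in\mathcal{X}}\operatorname{diam}X<\infty$; $\mathfrak{B}$ is the collection of all bounded metric families. Let $\mathfrak{C}$ be a collection of metric families and $n\in\mathbb{N}$. A metric family $\mathcal{X}$ is $n$-decomposable over $\mathfrak{C}$ if for every $r>0$, each $X\in\mathcal{X}$ has a decomposition $X=X_0\cup\dots\cup X_n$ where each $X_i$ is a union of subspaces $X_{ij}$, $j\in J_i$, with $d(x,y)>r$ whenever $x\in X_{ij}$, $y\in X_{ij'}$, $j\ne j'$, such that the family of all $X_{ij}$ (over all $X\in\mathcal{X}$, $0\le i\le n$, $j\in J_i$) is in $\mathfrak{C}$. $\mathcal{X}$ is strongly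 decomposable over $\mathfrak{C}$ if it is $1$-decomposable over $\mathfrak{C}$. $\mathcal{X}$ has finite asymptotic dimension if it is $n$-decomposable over $\mathfrak{B}$ for some $n\in\mathbb{N}$. FDC: let $\mathfrak{D}$ be the smallest collection of metric families containing $\mathfrak{B}$ that is closed under strong decomposition (i.e. any metric family strongly decomposable over $\mathfrak{D}$ is in $\mathfrak{D}$). A metric family has finite decomposition complexity (FDC) if it is in $\mathfrak{D}$. Regular FDC: let $\mathfrak{R}_0=\mathfrak{B}$. For an ordinal $\alpha>0$, $\mathcal{X}\in\mathfrak{R}_\alpha$ if there are a metric family $\mathcal{Y}$ with finite asymptotic dimension and a coarse map $F\colon\mathcal{X}\to\mathcal{Y}$ such that for every bounded subfamily $\mathcal{B}$ of $\mathcal{Y}$ there is an ordinal $\beta<\alpha$ with $F^{-1}(\mathcal{B})\in\mathfrak{R}_\beta$. A metric family has regular finite decomposition complexity if it lies in $\mathfrak{R}_\alpha$ for some countable ordinal $\alpha$. *)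

(* Defs.v *)
From Stdlib Require Import Reals ProofIrrelevance.

Local Open Scope R_scope.

Lemma subspace_dist_refl (X : Metric_Space) (P : Base X -> Prop)
    (x y : {z : Base X | P z}) :
  dist X (proj1_sig x) (proj1_sig y) = 0 <-> x = y.
Proof.
  rewrite (dist_refl X). split.
  - destruct x as [x px], y as [y py]; simpl. apply subset_eq_compat.
  - intros ->. reflexivity.
Qed.

Definition subspace (X : Metric_Space) (P : Base X -> Prop) : Metric_Space :=
  Build_Metric_Space {x : Base X | P x}
    (fun x y => dist X (proj1_sig x) (proj1_sig y))
    (fun x y => dist_pos X (proj1_sig x) (proj1_sig y))
    (fun x y => dist_sym X (proj1_sig x) (proj1_sig y))
    (subspace_dist_refl X P)
    (fun x y z => dist_tri X (proj1_sig x) (proj1_sig y) (proj1_sig z)).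

Definition metric_family : Type := Metric_Space -> Prop.

(* [sup_X diam X < oo]; empty spaces and the empty family are bounded. *)
Definition bounded (XX : metric_family) : Prop :=
  exists C : R, forall X, XX X -> forall x y : Base X, dist X x y <= C.

Definition map_collection : Type :=
  forall X Y : Metric_Space, (Base X -> Base Y) -> Prop.

Definition is_family_map (XX YY : metric_family) (F : map_collection) : Prop :=
  (forall X Y f, F X Y f -> XX X /\ YY Y) /\
  (forall X, XX X -> exists Y f, F X Y f).

Definition coarse (F : map_collection) : Prop :=
  exists rho : R -> R,
    (forall t, 0 <= t -> 0 <= rho t) /\
    (forall s t, 0 <= s -> s <= t -> rho s <= rho t) /\
    (forall X Y f, F X Y f ->
       forall x y, dist Y (f x) (f y) <= rho (dist X x y)).

(* A subfamily is given by pairs (Y, B) with B a subset of Y, so that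
   each member remembers the space it is a subspace of. *)
Definition subset_collection : Type :=
  forall Y : Metric_Space, (Base Y -> Prop) -> Prop.

Definition is_subfamily (BB : subset_collection) (YY : metric_family) : Prop :=
  forall Y B, BB Y B -> YY Y.

Definition family_of (BB : subset_collection) : metric_family :=
  fun Z => exists Y B, BB Y B /\ Z = subspace Y B.

Definition inverse_image (F : map_collection) (BB : subset_collection) :
    metric_family :=
  fun Z => exists X Y f B,
    F X Y f /\ BB Y B /\ Z = subspace X (fun x => B (f x)).

(* Only the indices [i <= n] of [part], [index] and [piece] are relevant. *)
Record decomposition (n : nat) (r : R) (X : Metric_Space) : Type := {
  part : nat -> Base X -> Prop;
  index : nat -> Type;
  piece : forall i, index i -> Base X -> Prop;
  part_cover : forall x, exists i, (i <= n)%nat /\ part i x;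
  part_union : forall i, (i <= n)%nat ->
    forall x, part i x <-> exists j, piece i j x;
  piece_disjoint : forall i, (i <= n)%nat ->
    forall j j', j <> j' ->
    forall x y, piece i j x -> piece i j' y -> dist X x y > r
}.

Arguments part {n r X} _ _ _.
Arguments index {n r X} _ _.
Arguments piece {n r X} _ _ _ _.

Definition pieces {n : nat} {r : R} (XX : metric_family)
    (D : forall X, decomposition n r X) : metric_family :=
  fun Z => exists X i (j : index (D X) i),
    XX X /\ (i <= n)%nat /\ Z = subspace X (piece (D X) i j).

(* [D] is total for convenience: spaces outside [XX] always have the trivial
   one-piece decomposition, and [pieces] ignores them. *)
Definition decomposable (n : nat) (CC : metric_family -> Prop)
    (XX : metric_family) : Prop :=
  forall r : R, 0 < r ->
    exists D : forall X, decomposition n r X, CC (pieces XX D).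

Definition strongly_decomposable (CC : metric_family -> Prop)
    (XX : metric_family) : Prop :=
  decomposable 1 CC XX.

Definition finite_asdim (XX : metric_family) : Prop :=
  exists n : nat, decomposable n bounded XX.

Definition closed_under_strong_decomposition
    (CC : metric_family -> Prop) : Prop :=
  forall XX, strongly_decomposable CC XX -> CC XX.

(* The intersection of all collections with the two required properties;
   the three lemmas below say that it is the smallest such collection. *)
Definition FDC (XX : metric_family) : Prop :=
  forall CC : metric_family -> Prop,
    (forall YY, bounded YY -> CC YY) ->
    closed_under_strong_decomposition CC ->
    CC XX.

Lemma FDC_bounded (XX : metric_family) : bounded XX -> FDC XX.
Proof. intros h CC hB _. exact (hB XX h). Qed.

Lemma FDC_closed : closed_under_strong_decomposition FDC.
Proof.
  intros XX h CC hB hC. apply hC. intros r hr.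
  destruct (h r hr) as [D hD]. exists D. exact (hD CC hB hC).
Qed.

Lemma FDC_least (CC : metric_family -> Prop) :
  (forall YY, bounded YY -> CC YY) ->
  closed_under_strong_decomposition CC ->
  forall XX, FDC XX -> CC XX.
Proof. intros hB hC XX h. exact (h CC hB hC). Qed.

Record ordinal : Type := {
  carrier :> Type;
  olt : carrier -> carrier -> Prop;
  olt_wf : well_founded olt;
  olt_trans : forall a b c, olt a b -> olt b c -> olt a c;
  olt_total : forall a b, olt a b \/ a = b \/ olt b a
}.

Arguments olt {_} _ _.

Definition ordinal_zero (alpha : ordinal) : Prop := alpha -> False.

(* [beta] is order-isomorphic to a proper initial segment of [alpha]. *)
Definition ordinal_lt (beta alpha : ordinal) : Prop :=
  exists (a : alpha) (g : beta -> alpha),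
    (forall x y, olt x y <-> olt (g x) (g y)) /\
    (forall z, olt z a <-> exists x, g x = z).

(* Finite or countably infinite. *)
Definition ordinal_countable (alpha : ordinal) : Prop :=
  exists c : alpha -> nat, forall a b, c a = c b -> a = b.

(* R_alpha by transfinite recursion on alpha, well-foundedness of [ordinal_lt]
   making the inductive and recursive definitions agree. *)
Inductive regular : ordinal -> metric_family -> Prop :=
| regular_zero : forall alpha XX,
    ordinal_zero alpha -> bounded XX -> regular alpha XX
| regular_pos : forall alpha XX YY (F : map_collection),
    ~ ordinal_zero alpha ->
    finite_asdim YY ->
    is_family_map XX YY F ->
    coarse F ->
    (forall BB, is_subfamily BB YY -> bounded (family_of BB) ->
       exists beta, ordinal_lt beta alpha /\ regular beta (inverse_image F BB)) ->
    regular alpha XX.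

Definition regular_FDC (XX : metric_family) : Prop :=
  exists alpha : ordinal, ordinal_countable alpha /\ regular alpha XX.

(* Main.v *)
From Stdlib Require Import Arith Reals Lra Lia ClassicalEpsilon
  FunctionalExtensionality PropExtensionality.
Require Import Defs.

(** Regular decomposition complexity is built from coarse maps to families of
    finite asymptotic dimension, so by induction on the ordinal two facts
    suffice.

    _Fibering_ ([FDC_fibering]): if [F : XX -> YY] is coarse, [YY] has FDC and
    the inverse images of bounded subfamilies of [YY] have FDC, then [XX] has
    FDC.  A strong decomposition of [YY] at scale [rho r] pulls back along [F]
    to one of [XX] at scale [r], and the pieces of [XX] again map coarsely to
    the pieces of [YY]; so the property passes up the construction of [YY]
    from bounded families.

    _Finite asymptotic dimension implies FDC_ ([decomposable_FDC]): a family of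
    asymptotic dimension at most [n + 1] is strongly decomposable over the
    families of asymptotic dimension at most [n]
    ([asdim_strongly_decomposable]), and one inducts on [n].  Fix [r].  Take
    covers of each space by [n + 2] colors of uniformly bounded, widely
    separated cells, at a rapidly growing sequence of scales, and look only at
    color 0.  Enlarge each of its cells to a core which swallows the smaller
    structures that it comes near, so that two cores of different scales are
    either more than [3 r] apart, or the larger one contains the [3 r]-
    neighborhood of the smaller one.  Now cut each space along the outer
    [r]-collars of all the cores.  The collars are [r]-disjoint, and so are
    the sets obtained outside them by recording which cores a point belongs
    to.  No core splits any of these pieces.  Hence, at each scale, a piece
    either lies in a single core, and is bounded, or misses all cells of color
    0, and is covered by the other [n + 1] colors
    ([collar_decomposition_dichotomy]). *)

Local Open Scope R_scope.

(** * Building decompositions *)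

Definition cover_decomposition {n : nat} {r : R} {X : Metric_Space}
    (I : nat -> Type) (P : forall i, I i -> Base X -> Prop)
    (cover : forall x, exists i, (i <= n)%nat /\ exists j, P i j x)
    (disjoint : forall i, (i <= n)%nat -> forall j j', j <> j' ->
       forall x y, P i j x -> P i j' y -> dist X x y > r) :
    decomposition n r X :=
  Build_decomposition n r X (fun i x => exists j, P i j x) I P cover
    (fun _ _ _ => iff_refl _) disjoint.

Lemma piece_cover {n r X} (d : decomposition n r X) (x : Base X) :
  exists i, (i <= n)%nat /\ exists j, piece d i j x.
Proof.
  destruct (part_cover _ _ _ d x) as (i & hi & hx).
  exists i. split; [exact hi |]. now apply (part_union _ _ _ d i hi).
Qed.

Definition pullback {n : nat} {r s : R} {X Y : Metric_Space}
    (f : Base X -> Base Y)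
    (hf : forall x y, dist X x y <= r -> dist Y (f x) (f y) <= s)
    (d : decomposition n s Y) : decomposition n r X.
Proof.
  refine (cover_decomposition (index d) (fun i j x => piece d i j (f x))
            (fun x => piece_cover d (f x)) _).
  intros i hi j j' hj x y hx hy.
  destruct (Rle_or_lt (dist X x y) r) as [hle | hlt]; [| exact hlt].
  pose proof (hf _ _ hle).
  pose proof (piece_disjoint _ _ _ d i hi j j' hj _ _ hx hy). lra.
Defined.

Definition one_piece (n : nat) (r : R) (X : Metric_Space) :
  decomposition n r X.
Proof.
  refine (cover_decomposition (fun _ => unit) (fun _ _ _ => True) _ _).
  - intros x. exists 0%nat. split; [lia | now exists tt].
  - intros i _ [] [] hj. now contradiction hj.
Defined.

(** Turns an existence statement about the members of a family into the total
    choice of decompositions that [decomposable] asks for. *)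
Lemma choose_decompositions (n : nat) (r : R) (XX : metric_family)
    (good : forall X, decomposition n r X -> Prop) :
  (forall X, XX X -> exists d, good X d) ->
  exists D : forall X, decomposition n r X, forall X, XX X -> good X (D X).
Proof.
  intros h.
  assert (h' : forall X, exists d : decomposition n r X, XX X -> good X d).
  { intros X. destruct (excluded_middle_informative (XX X)) as [hX | hX].
    - destruct (h X hX) as [d hd]. now exists d.
    - now exists (one_piece n r X). }
  exists (fun X => proj1_sig (constructive_indefinite_description _ (h' X))).
  intros X. exact (proj2_sig (constructive_indefinite_description _ (h' X))).
Qed.

Definition diam_le {X : Metric_Space} (P : Base X -> Prop) (C : R) : Prop :=
  forall x y, P x -> P y -> dist X x y <= C.

Definition pieces_diam_le {n r X} (d : decomposition n r X) (C : R) : Prop :=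
  forall i, (i <= n)%nat -> forall j, diam_le (piece d i j) C.

(** Asymptotic dimension at most [n], stated space by space with a common
    diameter bound; the bound is made nonnegative because an empty family is
    bounded by any number. *)
Lemma decomposable_boundedE (n : nat) (XX : metric_family) :
  decomposable n bounded XX <->
  forall r, 0 < r -> exists C, 0 <= C /\ forall X, XX X ->
    exists d : decomposition n r X, pieces_diam_le d C.
Proof.
  split; intros h r hr.
  - destruct (h r hr) as (D & C & hC). exists (Rmax 0 C).
    split; [apply Rmax_l |]. intros X hX. exists (D X).
    intros i hi j x y hx hy. apply Rle_trans with C; [| apply Rmax_r].
    exact (hC _ (ex_intro _ X (ex_intro _ i (ex_intro _ j
             (conj hX (conj hi eq_refl))))) (exist _ x hx) (exist _ y hy)).
  - destruct (h r hr) as (C & _ & hC).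
    destruct (choose_decompositions n r XX (fun X d => pieces_diam_le d C) hC)
      as [D hD].
    exists D, C. intros Z (X & i & j & hX & hi & ->) [x hx] [y hy].
    exact (hD X hX i hi j x y hx hy).
Qed.

(** The scale [s] depends on [r] and [rho] only, so that [D] can be chosen after
    it; each space uses a single map of [F] to pull back its decomposition. *)
Lemma pullback_pieces (n : nat) (XX : metric_family) (F : map_collection)
    (rho : R -> R) (r : R) :
  (forall X, XX X -> exists Y f, F X Y f) ->
  (forall s t, 0 <= s -> s <= t -> rho s <= rho t) ->
  (forall X Y f, F X Y f ->
     forall x y, dist Y (f x) (f y) <= rho (dist X x y)) ->
  exists s, 0 < s /\ forall D : forall Y, decomposition n s Y,
    exists D' : forall X, decomposition n r X,
    forall Z, pieces XX D' Z ->
    exists X Y f i (j : index (D Y) i), F X Y f /\ (i <= n)%nat /\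
      Z = subspace X (fun x => piece (D Y) i j (f x)).
Proof.
  intros hF hmono hrho.
  exists (Rmax 1 (rho r)).
  split; [apply Rlt_le_trans with 1; [lra | apply Rmax_l] |]. intros D.
  destruct (choose_decompositions n r XX (fun X d => exists Y f, F X Y f /\
    forall i (j : index d i), exists j' : index (D Y) i,
      piece d i j = fun x => piece (D Y) i j' (f x))) as [D' hD'].
  - intros X hX. destruct (hF X hX) as (Y & f & hf).
    assert (hc : forall x y, dist X x y <= r ->
                   dist Y (f x) (f y) <= Rmax 1 (rho r)).
    { intros x y hxy.
      apply Rle_trans with (rho (dist X x y)); [now apply hrho |].
      apply Rle_trans with (rho r); [| apply Rmax_r].
      apply hmono; [apply Rge_le, dist_pos | exact hxy]. }
    exists (pullback f hc (D Y)), Y, f. split; [exact hf |].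
    intros i j. now exists j.
  - exists D'. intros Z (X & i & j & hX & hi & ->).
    destruct (hD' X hX) as (Y & f & hf & hp). destruct (hp i j) as [j' ->].
    exists X, Y, f, i, j'. auto.
Qed.

(** * Permanence of finite decomposition complexity *)

Definition isometric {X Y : Metric_Space} (f : Base X -> Base Y) : Prop :=
  forall x y, dist Y (f x) (f y) = dist X x y.

Definition embeds (XX YY : metric_family) : Prop :=
  forall X, XX X -> exists Y (f : Base X -> Base Y), YY Y /\ isometric f.

Definition restrict {X Y : Metric_Space} (f : Base X -> Base Y)
    (Q : Base Y -> Prop) :
    Base (subspace X (fun x => Q (f x))) -> Base (subspace Y Q) :=
  fun z => exist _ (f (proj1_sig z)) (proj2_sig z).

(** Besides heredity, this identifies a space with its full subspace, and a
    subspace of a subspace with a subspace. *)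
Lemma FDC_embeds (XX YY : metric_family) :
  embeds XX YY -> FDC YY -> FDC XX.
Proof.
  intros he hY. revert XX he.
  apply (hY (fun YY => forall XX, embeds XX YY -> FDC XX)); clear YY hY.
  - intros YY [C hC] XX he. apply FDC_bounded. exists C. intros X hX x y.
    destruct (he X hX) as (Y & f & hY & hf). rewrite <- hf. now apply hC.
  - intros YY hdec XX he. apply FDC_closed. intros r _.
    destruct (pullback_pieces 1 XX (fun X Y f => YY Y /\ isometric f)
                (fun t => t) r) as (s & hs & hpull).
    + exact he.
    + auto.
    + intros X Y f [_ hf] x y. rewrite hf. apply Rle_refl.
    + destruct (hdec s hs) as [D hD]. destruct (hpull D) as [D' hD'].
      exists D'. apply hD. intros Z hZ.
      destruct (hD' Z hZ) as (X & Y & f & i & j & [hY hf] & hi & ->).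
      exists (subspace Y (piece (D Y) i j)), (restrict f _). split.
      * now exists Y, i, j.
      * intros x y. apply hf.
Qed.

(** The maps induced by [F] between pieces; [ZZ] cuts the domains down to the
    pieces that the pulled-back decompositions really have. *)
Inductive restricted_maps (F : map_collection) (n : nat) (s : R)
    (D : forall Y, decomposition n s Y) (ZZ : metric_family) :
    map_collection :=
| restricted_maps_intro : forall X Y f i (j : index (D Y) i),
    F X Y f -> (i <= n)%nat ->
    ZZ (subspace X (fun x => piece (D Y) i j (f x))) ->
    restricted_maps F n s D ZZ (subspace X (fun x => piece (D Y) i j (f x)))
      (subspace Y (piece (D Y) i j)) (restrict f (piece (D Y) i j)).

(** The property of [YY] is proved for all [XX] and [F] at once, because in the
    inductive step it is applied to the restrictions of [F] to pieces. *)
Lemma FDC_fibering (YY XX : metric_family) (F : map_collection) :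
  FDC YY -> is_family_map XX YY F -> coarse F ->
  (forall BB, is_subfamily BB YY -> bounded (family_of BB) ->
     FDC (inverse_image F BB)) ->
  FDC XX.
Proof.
  intros hY. revert XX F.
  apply (hY (fun YY => forall XX F, is_family_map XX YY F -> coarse F ->
    (forall BB, is_subfamily BB YY -> bounded (family_of BB) ->
       FDC (inverse_image F BB)) -> FDC XX)); clear YY hY.
  - intros YY [C hC] XX F [hF htot] _ hinv.
    apply FDC_embeds
      with (inverse_image F (fun Y B => YY Y /\ B = fun _ => True)).
    + intros X hX. destruct (htot X hX) as (Y & f & hf).
      exists (subspace X (fun _ => True)), (fun x => exist _ x I). split.
      * exists X, Y, f, (fun _ => True). destruct (hF X Y f hf). auto.
      * intros x y. reflexivity.
    + apply hinv.
      * now intros Y B [hY _].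
      * exists C. intros Z (Y & B & [hY ->] & ->) x y.
        exact (hC Y hY (proj1_sig x) (proj1_sig y)).
  - intros YY hdec XX F [hF htot] (rho & hpos & hmono & hrho) hinv.
    apply FDC_closed. intros r _.
    destruct (pullback_pieces 1 XX F rho r htot hmono hrho)
      as (s & hs & hpull).
    destruct (hdec s hs) as [D hD]. destruct (hpull D) as [D' hD'].
    exists D'. apply (hD _ (restricted_maps F 1 s D (pieces XX D'))).
    + split.
      * intros Z W g hg. destruct hg as [X Y f i j hf hi hZ].
        split; [exact hZ |]. exists Y, i, j.
        destruct (hF X Y f hf). auto.
      * intros Z hZ.
        destruct (hD' Z hZ) as (X & Y & f & i & j & hf & hi & ->).
        exists (subspace Y (piece (D Y) i j)), (restrict f _). now constructor.
    + exists rho. split; [exact hpos |]. split; [exact hmono |].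
      intros Z W g hg. destruct hg as [X Y f i j hf hi hZ].
      intros x y. now apply (hrho X Y f).
    + intros BB hsub [C hC].
      (* A subset of a piece of [Y] is a subset of [Y], which turns a bounded
         subfamily of the pieces into a bounded subfamily of [YY]. *)
      apply FDC_embeds with (inverse_image F (fun Y B' => YY Y /\
        exists i (j : index (D Y) i) B, BB (subspace Y (piece (D Y) i j)) B /\
          B' = fun y => exists h, B (exist _ y h))).
      * intros Z (Z0 & W & g & B & hg & hB & ->).
        destruct hg as [X Y f i j hf hi hZ].
        pose (Q := piece (D Y) i j).
        pose (B' := fun y => exists h : Q y, B (exist Q y h)).
        assert (hB' : forall z, B (restrict f Q z) -> B' (f (proj1_sig z))).
        { intros z hz. exact (ex_intro _ (proj2_sig z) hz). }
        exists (subspace X (fun x => B' (f x))),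
          (fun z => exist (fun x => B' (f x)) (proj1_sig (proj1_sig z))
                      (hB' (proj1_sig z) (proj2_sig z))).
        split.
        -- exists X, Y, f, B'.
           split; [exact hf |]. split; [| reflexivity].
           destruct (hF X Y f hf) as [_ hY]. split; [exact hY |].
           now exists i, j, B.
        -- intros x y. reflexivity.
      * apply hinv; [now intros Y B [hY _] |].
        exists C. intros Z (Y & B' & (hY & i & j & B & hB & ->) & ->)
          [x [hx hBx]] [y [hy hBy]].
        exact (hC _ (ex_intro _ _ (ex_intro _ B (conj hB eq_refl)))
                 (exist _ (exist _ x hx) hBx) (exist _ (exist _ y hy) hBy)).
Qed.

(** * Laminar families of cells *)

Section Cells.

Context {X : Metric_Space} (sigma : R) (sigma_pos : 0 < sigma).

Local Notation pset := (Base X -> Prop).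

Definition incl (P Q : pset) : Prop := forall x, P x -> Q x.

Definition near (P Q : pset) : Prop :=
  exists x y, P x /\ Q y /\ dist X x y <= sigma.

Definition thicken (P : pset) : pset :=
  fun x => exists y, P y /\ dist X x y <= sigma.

(** One round of absorption is enough when [fam] is laminar: see
    [absorb_saturated]. *)
Definition absorb (fam : pset -> Prop) (W : pset) : pset :=
  fun x => W x \/ exists H, fam H /\ near H W /\ H x.

Definition laminar (fam : pset -> Prop) : Prop :=
  forall H H', fam H -> fam H' -> near H H' -> incl H H' \/ incl H' H.

Lemma dist_self (x : Base X) : dist X x x = 0.
Proof. now apply dist_refl. Qed.

Lemma near_sym (P Q : pset) : near P Q -> near Q P.
Proof.
  intros (x & y & hx & hy & h). exists y, x. rewrite dist_sym. auto.
Qed.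

Lemma near_mono (P P' Q Q' : pset) :
  incl P P' -> incl Q Q' -> near P Q -> near P' Q'.
Proof. intros hP hQ (x & y & hx & hy & h). exists x, y. auto. Qed.

Lemma incl_thicken (P : pset) : incl P (thicken P).
Proof. intros x hx. exists x. rewrite dist_self. split; [auto | lra]. Qed.

Lemma incl_absorb fam (W : pset) : incl W (absorb fam W).
Proof. intros x hx. now left. Qed.

(** If [H] comes near some absorbed [H'], the two are nested: either [H] lies in
    [H'], or [H] contains [H'] and so is itself near [W]. *)
Lemma absorb_saturated fam (W H : pset) :
  laminar fam -> fam H -> near H (absorb fam W) -> incl H (absorb fam W).
Proof.
  intros hlam hH (x & y & hx & [hy | (H' & hH' & hn & hy)] & hxy) z hz.
  - right. exists H. split; [exact hH |]. split; [now exists x, y | exact hz].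
  - right. destruct (hlam H H' hH hH') as [hi | hi]; [now exists x, y | |].
    + exists H'. auto.
    + exists H. split; [exact hH |]. split; [| exact hz].
      apply near_mono with H' W; [exact hi | now intros t | exact hn].
Qed.

Lemma absorb_within fam (W : pset) (b : R) (x : Base X) :
  0 <= b -> (forall H, fam H -> diam_le H b) -> absorb fam W x ->
  exists w, W w /\ dist X x w <= b + sigma.
Proof.
  intros hb hfam [hx | (H & hH & (h & w & hh & hw & hhw) & hx)].
  - exists x. rewrite dist_self. split; [exact hx | lra].
  - exists w. split; [exact hw |].
    pose proof (hfam H hH x h hx hh). pose proof (dist_tri X x w h). lra.
Qed.

Context {I : nat -> Type} (U : forall k, I k -> pset).

(** Absorbing twice with a thickening in between yields two saturated sets, the
    core [absorb fam W] and this halo around it, with a margin [sigma] between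
    them.  A larger core that comes near the smaller core then swallows the
    whole halo, and with it the margin. *)
Definition halo_in (fam : pset -> Prop) (W : pset) : pset :=
  absorb fam (thicken (absorb fam W)).

(** The halos of all cells [U i j] with [i < k]. *)
Fixpoint halos (k : nat) : pset -> Prop :=
  match k with
  | O => fun _ => False
  | S k => fun H => halos k H \/ exists j, H = halo_in (halos k) (U k j)
  end.

Definition core (k : nat) (j : I k) : pset := absorb (halos k) (U k j).
Definition halo (k : nat) (j : I k) : pset := halo_in (halos k) (U k j).

Context (C : R -> R) (C_ge0 : forall s, 0 < s -> 0 <= C s).

(** [C s] bounds the diameter of the cells that are used at scale [s], and
    [halo_bound k] bounds that of the halos of levels below [k].  A halo of
    level [k] stays within [2 * halo_bound k + 3 * sigma] of its cell, which
    costs twice this distance in diameter; the separation [scale k] of the cells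
    exceeds twice this distance by [sigma], and the term [INR k] makes the scales
    unbounded. *)
Fixpoint halo_bound (k : nat) : R :=
  match k with
  | O => 0
  | S k => C (4 * halo_bound k + 7 * sigma + INR k)
             + 4 * halo_bound k + 6 * sigma
  end.

Definition scale (k : nat) : R := 4 * halo_bound k + 7 * sigma + INR k.

Lemma halo_boundS (k : nat) :
  halo_bound (S k) = C (scale k) + 4 * halo_bound k + 6 * sigma.
Proof. reflexivity. Qed.

Lemma halo_bound_ge0 (k : nat) : 0 <= halo_bound k.
Proof.
  induction k as [| k IH]; [simpl; lra |]. rewrite halo_boundS.
  assert (0 <= C (scale k)); [| lra].
  apply C_ge0. unfold scale. pose proof (pos_INR k). lra.
Qed.

Lemma scale_ge (k : nat) : INR k <= scale k.
Proof. unfold scale. pose proof (halo_bound_ge0 k). lra. Qed.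

Lemma scale_pos (k : nat) : 0 < scale k.
Proof.
  unfold scale. pose proof (halo_bound_ge0 k). pose proof (pos_INR k). lra.
Qed.

Lemma C_le_halo_bound (k : nat) : C (scale k) <= halo_bound (S k).
Proof. rewrite halo_boundS. pose proof (halo_bound_ge0 k). lra. Qed.

Lemma halo_bound_incr (k : nat) : halo_bound k <= halo_bound (S k).
Proof.
  rewrite halo_boundS. pose proof (halo_bound_ge0 k).
  pose proof (C_ge0 _ (scale_pos k)). lra.
Qed.

Context (U_diam : forall k j, diam_le (U k j) (C (scale k))).
Context (U_sep : forall k j j', j <> j' ->
  forall x y, U k j x -> U k j' y -> dist X x y > scale k).

Lemma halo_within (k : nat) (j : I k) (x : Base X) :
  (forall H, halos k H -> diam_le H (halo_bound k)) -> halo k j x ->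
  exists u, U k j u /\ dist X x u <= 2 * halo_bound k + 3 * sigma.
Proof.
  intros hk hx. pose proof (halo_bound_ge0 k) as hb.
  destruct (absorb_within _ _ _ _ hb hk hx) as (y & (z & hz & hyz) & hxy).
  destruct (absorb_within _ _ _ _ hb hk hz) as (u & hu & hzu).
  exists u. split; [exact hu |].
  pose proof (dist_tri X x u y). pose proof (dist_tri X y u z). lra.
Qed.

Lemma halos_diam (k : nat) :
  forall H, halos k H -> diam_le H (halo_bound k).
Proof.
  induction k as [| k IH]; [intros H [] |].
  intros H [hH | [j ->]] x y hx hy.
  - apply Rle_trans with (halo_bound k); [now apply (IH H) |].
    apply halo_bound_incr.
  - destruct (halo_within k j x IH hx) as (u & hu & hxu).
    destruct (halo_within k j y IH hy) as (v & hv & hyv).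
    pose proof (U_diam k j u v hu hv).
    pose proof (dist_tri X x y u). pose proof (dist_tri X u y v).
    rewrite (dist_sym X y v) in hyv. rewrite halo_boundS. lra.
Qed.

Lemma halo_sep (k : nat) (j j' : I k) :
  j <> j' -> ~ near (halo k j) (halo k j').
Proof.
  intros hj (x & y & hx & hy & hxy).
  destruct (halo_within k j x (halos_diam k) hx) as (u & hu & hxu).
  destruct (halo_within k j' y (halos_diam k) hy) as (v & hv & hyv).
  pose proof (U_sep k j j' hj u v hu hv) as huv.
  pose proof (dist_tri X u v x). pose proof (dist_tri X x v y).
  rewrite (dist_sym X u x) in *. unfold scale in huv.
  pose proof (pos_INR k). lra.
Qed.

Lemma halos_laminar (k : nat) : laminar (halos k).
Proof.
  induction k as [| k IH]; [intros H H' [] |].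
  intros H H' [hH | [j ->]] [hH' | [j' ->]] hn.
  - now apply IH.
  - left. now apply absorb_saturated.
  - right. apply absorb_saturated; [exact IH | exact hH' |].
    now apply near_sym.
  - destruct (classic (j = j')) as [-> | hj]; [left; now intros x |].
    now destruct (halo_sep k j j' hj).
Qed.

Lemma halos_le (i k : nat) (j : I i) : (i < k)%nat -> halos k (halo i j).
Proof.
  intros h. induction h; [right; now exists j | now left].
Qed.

Lemma incl_thicken_core_halo (k : nat) (j : I k) :
  incl (thicken (core k j)) (halo k j).
Proof. apply incl_absorb. Qed.

Lemma incl_core_halo (k : nat) (j : I k) : incl (core k j) (halo k j).
Proof. intros x hx. now apply incl_thicken_core_halo, incl_thicken. Qed.

Lemma core_diam (k : nat) (j : I k) : diam_le (core k j) (halo_bound (S k)).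
Proof.
  intros x y hx hy.
  apply (halos_diam (S k) (halo k j)); [| now apply incl_core_halo ..].
  apply halos_le. lia.
Qed.

Lemma core_sep (k : nat) (j j' : I k) :
  j <> j' -> ~ near (core k j) (core k j').
Proof.
  intros hj hn. apply (halo_sep k j j' hj).
  now apply near_mono with (core k j) (core k j'); [apply incl_core_halo .. |].
Qed.

(** This is what the halos are for.  The relation is between levels [i < k]
    only: near cores of one level are equal by [core_sep]. *)
Lemma core_nested (i k : nat) (j : I i) (j' : I k) :
  (i < k)%nat -> near (core i j) (core k j') ->
  incl (thicken (core i j)) (core k j').
Proof.
  intros hik hn x hx.
  apply absorb_saturated with (halo i j).
  - apply halos_laminar.
  - now apply halos_le.
  - apply near_mono with (core i j) (core k j');
      [apply incl_core_halo | now intros y | exact hn].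
  - now apply incl_thicken_core_halo.
Qed.

(** * Cutting along collars *)

Context (r : R) (r_pos : 0 < r) (sigmaE : sigma = 3 * r).

(** Taken outside the core: inner collars would be crossed by the smaller cores
    inside. *)
Definition collar (k : nat) (j : I k) : pset :=
  fun x => ~ core k j x /\ exists y, core k j y /\ dist X x y <= r.

(** Cores do not split collars.  A core that meets the collar is near the
    collared core.  At the same level the two would coincide, at a lower level
    it would lie inside the collared core; at a higher level it contains the
    margin, hence the collar. *)
Lemma collar_core (k l : nat) (j : I k) (j' : I l) (x : Base X) :
  collar k j x -> core l j' x ->
  (k < l)%nat /\ incl (collar k j) (core l j').
Proof.
  intros [hx (y & hy & hxy)] hx'.
  assert (hn : near (core k j) (core l j')).
  { exists y, x. rewrite (dist_sym X y x). split; [auto |].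
    split; [auto | lra]. }
  destruct (lt_eq_lt_dec k l) as [[h | <-] | h].
  - split; [exact h |]. intros z [_ (t & ht & hzt)].
    apply (core_nested k l j j' h hn). exists t. split; [exact ht | lra].
  - destruct (classic (j = j')) as [<- | hj]; [contradiction |].
    now destruct (core_sep k j j' hj).
  - destruct hx.
    apply (core_nested l k j' j h (near_sym _ _ hn)). now apply incl_thicken.
Qed.

(** Otherwise the smaller core is within [3 r = sigma] of the larger one, which
    then contains the point [y] of its own outer collar. *)
Lemma collar_nested (k l : nat) (j : I k) (j' : I l) (x y : Base X) :
  (k < l)%nat -> collar k j x -> collar l j' y -> dist X x y > r.
Proof.
  intros h [_ (x' & hx' & hxx')] [hy (y' & hy' & hyy')].
  apply Rnot_le_gt. intros hxy. apply hy.
  pose proof (dist_tri X y x' x). rewrite (dist_sym X y x) in *.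
  pose proof (dist_tri X x' y' y). rewrite (dist_sym X x' y) in *.
  apply (core_nested k l j j' h).
  - exists x', y'. split; [exact hx' |]. split; [exact hy' | lra].
  - exists x'. split; [exact hx' | lra].
Qed.

Lemma collar_sep (p q : {k : nat & I k}) (x y : Base X) :
  p <> q -> collar (projT1 p) (projT2 p) x -> collar (projT1 q) (projT2 q) y ->
  dist X x y > r.
Proof.
  destruct p as [k j], q as [l j']; simpl. intros hpq hx hy.
  destruct (lt_eq_lt_dec k l) as [[h | <-] | h].
  - now apply (collar_nested k l j j').
  - assert (hj : j <> j') by (intros ->; now apply hpq).
    apply Rnot_le_gt. intros hxy. apply (core_sep k j j' hj).
    destruct hx as [_ (x' & hx' & hxx')], hy as [_ (y' & hy' & hyy')].
    exists x', y'. split; [exact hx' |]. split; [exact hy' |].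
    pose proof (dist_tri X x' y' x). pose proof (dist_tri X x y' y).
    rewrite (dist_sym X x' x) in *. lra.
  - rewrite dist_sym. now apply (collar_nested l k j' j).
Qed.

(** Classes are indexed by the set [Q] of cores that their points belong to. *)
Definition class (Q : forall k, I k -> Prop) : pset :=
  fun x => (forall k j, ~ collar k j x) /\ forall k j, Q k j <-> core k j x.

(** Moving by at most [r] into a core means starting in its collar. *)
Lemma class_sep (Q Q' : forall k, I k -> Prop) (x y : Base X) :
  Q <> Q' -> class Q x -> class Q' y -> dist X x y > r.
Proof.
  intros hQ [hx hQx] [hy hQy]. apply Rnot_le_gt. intros hxy. apply hQ.
  apply functional_extensionality_dep. intros k.
  apply functional_extensionality. intros j.
  apply propositional_extensionality. rewrite hQx, hQy. split; intros h.
  - apply NNPP. intros h'. apply (hy k j). split; [exact h' |].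
    exists x. rewrite dist_sym. auto.
  - apply NNPP. intros h'. apply (hx k j). split; [exact h' |].
    exists y. auto.
Qed.

Definition collar_decomposition : decomposition 1 r X.
Proof.
  refine (cover_decomposition
    (fun i => match i with
              | O => {k : nat & I k}
              | S _ => forall k, I k -> Prop
              end)
    (fun i => match i with
              | O => fun p => collar (projT1 p) (projT2 p)
              | S _ => class
              end) _ _).
  - intros x. destruct (classic (exists k j, collar k j x)) as [h | h].
    + destruct h as (k & j & h). exists 0%nat. split; [lia |].
      now exists (existT _ k j).
    + exists 1%nat. split; [lia |]. exists (fun k j => core k j x).
      split; [| easy]. intros k j hx. apply h. now exists k, j.
  - intros [| i] _ j j' hj x y hx hy.
    + now apply (collar_sep j j').
    + now apply (class_sep j j').
Defined.

Lemma collar_decomposition_dichotomy (i : nat)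
    (j : index collar_decomposition i) (k : nat) :
  diam_le (piece collar_decomposition i j) (halo_bound (S k)) \/
  (forall x, piece collar_decomposition i j x -> forall j', ~ U k j' x).
Proof.
  destruct (classic (exists x j',
    piece collar_decomposition i j x /\ core k j' x))
    as [(x & j' & hx & hx') | h].
  - left. assert (hi : incl (piece collar_decomposition i j) (core k j')).
    { destruct i as [| i]; simpl in *.
      - now apply (collar_core _ k _ j' x).
      - intros y [_ hy]. apply hy. now apply (proj2 hx). }
    intros y z hy hz. now apply (core_diam k j'); apply hi.
  - right. intros x hx j' hU. apply h. exists x, j'. split; [exact hx |].
    now apply incl_absorb.
Qed.

End Cells.

(** * Lowering the asymptotic dimension *)

(** A piece inside a bounded set is left whole; one that misses color 0 inherits
    the remaining colors, renumbered. *)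
Lemma drop_color (n : nat) (s b c : R) (X : Metric_Space)
    (d : decomposition (S n) s X) (P : Base X -> Prop) :
  c <= b -> pieces_diam_le d c ->
  diam_le P b \/ (forall x, P x -> forall j, ~ piece d 0 j x) ->
  exists e : decomposition n s (subspace X P), pieces_diam_le e b.
Proof.
  intros hcb hd [hP | hP].
  - exists (one_piece n s _). intros i _ j [x hx] [y hy] _ _. now apply hP.
  - assert (hcov : forall z : Base (subspace X P), exists i, (i <= n)%nat /\
              exists j, piece d (S i) j (proj1_sig z)).
    { intros [x hx]. destruct (piece_cover d x) as ([| i] & hi & j & hj).
      - now destruct (hP x hx j).
      - exists i. split; [lia | now exists j]. }
    exists (cover_decomposition (X := subspace X P) (fun i => index d (S i))
      (fun i j z => piece d (S i) j (proj1_sig z)) hcov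
      (fun i hi j j' hj x y =>
         piece_disjoint _ _ _ d (S i) (le_n_S _ _ hi) j j' hj _ _)).
    intros i hi j x y hx hy. apply Rle_trans with c; [| exact hcb].
    exact (hd (S i) (le_n_S _ _ hi) j _ _ hx hy).
Qed.

Lemma coarsen (n : nat) (r s C : R) (X : Metric_Space)
    (d : decomposition n s X) :
  r <= s -> pieces_diam_le d C ->
  exists e : decomposition n r X, pieces_diam_le e C.
Proof.
  intros hrs hd.
  exists (pullback (fun x => x) (fun x y h => Rle_trans _ _ _ h hrs) d).
  exact hd.
Qed.

(** The cells of level [k] are those of color 0 at scale [scale sigma C k].
    The bound [C] is chosen before the scales, which are defined from it, and
    before any space is considered: hence all bounds are uniform over the
    family. *)
Lemma asdim_strongly_decomposable (n : nat) (XX : metric_family) :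
  decomposable (S n) bounded XX ->
  strongly_decomposable (decomposable n bounded) XX.
Proof.
  rewrite decomposable_boundedE. intros hXX r hr.
  assert (hC : exists C : R -> R, forall s, 0 < s -> 0 <= C s /\
    forall X, XX X ->
      exists d : decomposition (S n) s X, pieces_diam_le d (C s)).
  { assert (h : forall s, exists c, 0 < s -> 0 <= c /\ forall X, XX X ->
      exists d : decomposition (S n) s X, pieces_diam_le d c).
    { intros s. destruct (Rlt_dec 0 s) as [hs | hs].
      - destruct (hXX s hs) as [c hc]. now exists c.
      - exists 0. now intros hs'. }
    exists (fun s =>
      proj1_sig (constructive_indefinite_description _ (h s))).
    intros s.
    exact (proj2_sig (constructive_indefinite_description _ (h s))). }
  destruct hC as [C hC].
  assert (hC0 : forall s, 0 < s -> 0 <= C s) by (intros; now apply hC).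
  pose (sigma := 3 * r). assert (hsigma : 0 < sigma) by (unfold sigma; lra).
  destruct (choose_decompositions 1 r XX (fun X d =>
    forall i j k, exists e : decomposition n (scale sigma C k)
                               (subspace X (piece d i j)),
      pieces_diam_le e (halo_bound sigma C (S k)))) as [D hD].
  - intros X hX.
    assert (hd : forall k, exists d : decomposition (S n) (scale sigma C k) X,
              pieces_diam_le d (C (scale sigma C k))).
    { intros k. now apply hC; [apply scale_pos |]. }
    pose (d k := proj1_sig (constructive_indefinite_description _ (hd k))).
    assert (hdk : forall k, pieces_diam_le (d k) (C (scale sigma C k))).
    { intros k.
      exact (proj2_sig (constructive_indefinite_description _ (hd k))). }
    pose (U k := piece (d k) 0).
    assert (hU : forall k j, diam_le (U k j) (C (scale sigma C k))).
    { intros k j. apply hdk. lia. }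
    assert (hsep : forall k j j', j <> j' -> forall x y,
              U k j x -> U k j' y -> dist X x y > scale sigma C k).
    { intros k. apply piece_disjoint. lia. }
    exists (collar_decomposition sigma hsigma U C hC0 hU hsep r hr eq_refl).
    intros i j k. apply drop_color with (C (scale sigma C k)) (d k).
    + now apply C_le_halo_bound.
    + apply hdk.
    + exact (collar_decomposition_dichotomy sigma hsigma U C hC0 hU hsep
               r hr eq_refl i j k).
  - exists D. apply decomposable_boundedE. intros r' _.
    destruct (INR_unbounded r') as [k hk].
    exists (halo_bound sigma C (S k)). split; [now apply halo_bound_ge0 |].
    intros Z (X & i & j & hX & hi & ->). destruct (hD X hX i j k) as [e he].
    apply coarsen with (scale sigma C k) e; [| exact he].
    pose proof (scale_ge sigma hsigma C hC0 k). lra.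
Qed.

(** In dimension 0 a single color suffices; it is used for both colors of a
    strong decomposition. *)
Lemma decomposable_FDC (n : nat) (XX : metric_family) :
  decomposable n bounded XX -> FDC XX.
Proof.
  revert XX. induction n as [| n IH]; intros XX h;
    apply FDC_closed; intros r hr.
  - rewrite decomposable_boundedE in h. destruct (h r hr) as (C & _ & hC).
    destruct (choose_decompositions 1 r XX (fun X d => pieces_diam_le d C))
      as [D hD].
    + intros X hX. destruct (hC X hX) as [d hd].
      assert (hcov : forall x, exists i, (i <= 1)%nat /\
              exists j, piece d 0 j x).
      { intros x. destruct (piece_cover d x) as ([| i] & hi & hx); [| lia].
        exists 0%nat. split; [lia | exact hx]. }
      exists (cover_decomposition (fun _ => index d 0) (fun _ => piece d 0)
                hcov (fun _ _ => piece_disjoint _ _ _ d 0 (le_n 0))).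
      intros i _. now apply hd.
    + exists D. apply FDC_bounded. exists C.
      intros Z (X & i & j & hX & hi & ->) [x hx] [y hy].
      exact (hD X hX i hi j x y hx hy).
  - destruct (asdim_strongly_decomposable n XX h r hr) as [D hD].
    exists D. now apply IH.
Qed.

(** * Regular decomposition complexity *)

(** The induction runs over the derivation of [regular alpha XX], so that it
    needs no comparison of ordinals. *)
Lemma regular_is_FDC : forall (alpha : ordinal) (XX : metric_family),
  regular alpha XX -> FDC XX.
Proof.
  fix IH 3.
  intros alpha XX [alpha' XX' _ hb | alpha' XX' YY F _ [n hY] hF hc hinv].
  - now apply FDC_bounded.
  - apply (FDC_fibering YY XX' F);
      [now apply decomposable_FDC with n | exact hF | exact hc |].
    intros BB hsub hB. destruct (hinv BB hsub hB) as (beta & _ & hreg).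
    exact (IH _ _ hreg).
Qed.

Theorem theorem2p13 (XX : metric_family) (hXX : regular_FDC XX) : FDC XX.
Proof.
  destruct hXX as (alpha & _ & h). exact (regular_is_FDC alpha XX h).
Qed.
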